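(* Let $Q\in\mathbb{C}^{N\times N}$ be a matrix all of whose eigenvalues have positive real part. Then for every $x>0$ $$\frac{\partial \gamma(Q,x)}{\partial x}=x^{Q-I}e^{-x}\qquad\text{and}\qquad \frac{\partial \Gamma(Q,x)}{\partial x}=-x^{Q-I}e^{-x}.$$
   Context: $I$ is the identity matrix in $\mathbb{C}^{N\times N}$, and $t^{M}=\exp(M\ln t)$ for $t>0$ and $M\in\mathbb{C}^{N\times N}$. For a matrix $Q\in\mathbb{C}^{N\times N}$ all of whose eigenvalues have positive real part and $x>0$, the incomplete gamma matrix functions are $$\gamma(Q,x)=\int_0^x u^{Q-I}e^{-u}\,du,\qquad \Gamma(Q,x)=\int_x^\infty u^{Q-I}e^{-u}\,du .$$ *)

(* Defs.v *)
From HB Require Import structures.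
From mathcomp Require Import all_boot all_order all_algebra.
From mathcomp Require Import all_classical all_reals all_analysis.
From mathcomp Require Import complex.

Set Implicit Arguments.
Unset Strict Implicit.
Unset Printing Implicit Defensive.

Import Order.TTheory GRing.Theory Num.Theory.
Import numFieldNormedType.Exports.

Local Open Scope classical_set_scope.
Local Open Scope ring_scope.
Local Open Scope complex_scope.

(* Gives C, and hence the complex matrices, the topology of the modulus. *)
HB.instance Definition _ (R : rcfType) := NormedModule.copy R[i] (R[i])^o.

(* The limit is taken in the normed module 'M[R[i]]_N over the field R[i],
   whose norm is the maximum of the moduli of the entries. *)
Definition expmx (R : realType) (N : nat) (M : 'M[R[i]]_N) : 'M[R[i]]_N :=
  limn (series (fun k : nat => (k`!%:R : R[i])^-1 *: (M ^+ k : 'M[R[i]]_N))).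

(* t ^ M for t > 0; when t <= 0, [ln t] is the default value 0. *)
Definition powmx (R : realType) (N : nat) (t : R) (M : 'M[R[i]]_N) :
    'M[R[i]]_N :=
  expmx ((ln t)%:C *: M).

(* Entrywise Lebesgue integral of the real and imaginary parts. [Rintegral] is a
   total function, so this value is meaningful when the entries are integrable
   on D. *)
Definition mx_integral (R : realType) (N : nat) (D : set R)
    (F : R -> 'M[R[i]]_N) : 'M[R[i]]_N :=
  \matrix_(i, j)
    ((\int[lebesgue_measure]_(u in D) complex.Re (F u i j))
     +i* (\int[lebesgue_measure]_(u in D) complex.Im (F u i j))).

Definition gamma_integrand (R : realType) (N : nat) (Q : 'M[R[i]]_N) (u : R) :
    'M[R[i]]_N :=
  (expR (- u))%:C *: powmx u (Q - 1%:M).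

Definition lower_gammamx (R : realType) (N : nat) (Q : 'M[R[i]]_N) (x : R) :
    'M[R[i]]_N :=
  mx_integral `]0, x] (gamma_integrand Q).

Definition upper_gammamx (R : realType) (N : nat) (Q : 'M[R[i]]_N) (x : R) :
    'M[R[i]]_N :=
  mx_integral `[x, +oo[ (gamma_integrand Q).

(* [derive] needs a normed module over R, whereas the library's normed module
   'M[R[i]]_N is over R[i]; hence the limit of difference quotients along real
   increments is written out. *)
Definition has_mx_derivative (R : realType) (N : nat) (F : R -> 'M[R[i]]_N)
    (x : R) (L : 'M[R[i]]_N) : Prop :=
  (h^-1)%:C *: (F (x + h) - F x) @[h --> (0 : R)^'] --> L.

(* Main.v *)
(* With A = Q - I, the entries of exp(sA) P are power series in s which solve a
   linear system, so they are smooth in s = ln u; the theorem is then the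
   fundamental theorem of calculus applied entrywise, once the integrand is
   known to be integrable on ]0, +oo[. At infinity the bound exp(||A|| |s|) is
   absorbed by e^{-u}. Near 0 one needs |exp(sA)| = O(e^{ds}) as s -> -oo for
   some d > -1: by Cayley-Hamilton a product of factors A - r, with
   Re r > d > -1, annihilates P = I, and removing one factor at a time costs a
   scalar equation p' = r p + g with g = O(e^{ds}), handled by an energy
   estimate. *)
Require Import Defs.
From mathcomp Require Import all_boot all_order all_algebra.
From mathcomp Require Import all_classical all_reals all_analysis.
From mathcomp Require Import measurable_realfun complex.
From mathcomp Require Import ring lra.

Import Order.TTheory GRing.Theory Num.Theory.
Import numFieldNormedType.Exports.

Local Open Scope ring_scope.
Local Open Scope complex_scope.

Set Implicit Arguments.
Unset Strict Implicit.
Unset Printing Implicit Defensive.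
Local Open Scope classical_set_scope.

(** * Exponential generating functions of real sequences of geometric growth *)

Definition egf (R : realType) (a : R^nat) (s : R) : R :=
  limn (pseries (fun k => a k / k`!%:R) s).

Definition exp_bounded (R : realType) (M K : R) (a : R^nat) : Prop :=
  forall k, `|a k| <= M * K ^+ k.

Section egf.
Variables (R : realType) (M K : R).
Implicit Types (a b : R^nat) (s : R).
Hypotheses (M0 : 0 <= M) (K0 : 0 <= K).

(** Comparison with the exponential series at K|s|: absolute convergence for every s and the growth
    bound on [egf] both come from it. *)
Lemma egf_norm_term_le a s k : exp_bounded M K a ->
  `|a k / k`!%:R * s ^+ k| <= M * exp_coeff (K * `|s|) k.
Proof.
move=> ha; rewrite /exp_coeff /= exprMn !normrM normrX normfV normr_nat.
rewrite !mulrA mulrAC ler_pM2r ?invr_gt0 ?ltr0n ?fact_gt0//.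
by rewrite ler_wpM2r ?exprn_ge0// ha.
Qed.

Lemma egf_normed_cvg a s : exp_bounded M K a ->
  cvgn [normed series (fun k => a k / k`!%:R * s ^+ k)].
Proof.
move=> ha; apply: (@series_le_cvg _ _ (fun k => M * exp_coeff (K * `|s|) k)).
- by move=> k /=.
- by move=> k; rewrite mulr_ge0// exp_coeff_ge0// mulr_ge0.
- by move=> k; exact: egf_norm_term_le.
by apply: is_cvg_seriesZ; exact: is_cvg_series_exp_coeff.
Qed.

Lemma egf_cvg a s : exp_bounded M K a ->
  cvgn (pseries (fun k => a k / k`!%:R) s).
Proof. by move=> ha; apply: normed_cvg; exact: egf_normed_cvg. Qed.

Lemma egf_bound a s : exp_bounded M K a -> `|egf a s| <= M * expR (K * `|s|).
Proof.
move=> ha; have := lim_series_norm (@egf_normed_cvg a s ha).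
rewrite -/(pseries _ s) -/(egf _ _) => /le_trans; apply.
have ce := @is_cvg_series_exp_coeff R (K * `|s|).
rewrite /expR -[M * _](lim_seriesZ _ ce).
apply: lim_series_le; first exact: egf_normed_cvg.
  exact: is_cvg_seriesZ.
by move=> k; exact: egf_norm_term_le.
Qed.

End egf.

Section egf_theory.
Variables (R : realType).
Implicit Types (a b : R^nat) (s : R).

(** The factor k+1 produced by differentiation cancels against (k+1)!, so differentiating [egf a]
    shifts [a]. For the sequence of matrix powers this shift is multiplication by the matrix. *)
Lemma egf_diffs a :
  pseries_diffs (fun k => a k / k`!%:R) = (fun k => a k.+1 / k`!%:R).
Proof.
apply/funext => k; rewrite /pseries_diffs factS natrM.
by field; rewrite nat1r !pnatr_eq0 -lt0n fact_gt0.
Qed.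

Lemma exp_bounded_shift M K a :
  exp_bounded M K a -> exp_bounded (M * K) K (fun k => a k.+1).
Proof. by move=> ha k; rewrite -mulrA -exprS. Qed.

Lemma egf_is_derive M K a s : 0 <= M -> 0 <= K -> exp_bounded M K a ->
  is_derive s (1 : R) (egf a) (egf (fun k => a k.+1) s).
Proof.
move=> M0 K0 ha; rewrite /egf -egf_diffs.
have ha1 := exp_bounded_shift ha; have ha2 := exp_bounded_shift ha1.
(* Termwise differentiation asks for convergence of the series and of its first two formal
   derivatives at a point beyond |s|; |s| + 1 is such a point. *)
apply: (@pseries_snd_diffs _ _ (`|s| + 1)).
- exact: egf_cvg ha.
- by rewrite egf_diffs; apply: egf_cvg ha1 => //; rewrite mulr_ge0.
- by rewrite !egf_diffs; apply: egf_cvg ha2 => //; rewrite !mulr_ge0.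
- by rewrite [ltRHS]ger0_norm ?addr_ge0// ltrDl.
Qed.

Lemma egf0 s : egf (fun=> 0) s = 0 :> R.
Proof.
rewrite /egf (_ : pseries _ _ = fun=> 0) ?lim_cst//.
by apply/funext => n; rewrite /pseries /series /= big1// => k _; rewrite !mul0r.
Qed.

(** The three-term shape is that of the real or imaginary part of z w + w', where z is a fixed
    complex number. *)
Lemma egf_linear_comb c d a1 a2 a3 s :
  cvgn (pseries (fun k => a1 k / k`!%:R) s) ->
  cvgn (pseries (fun k => a2 k / k`!%:R) s) ->
  cvgn (pseries (fun k => a3 k / k`!%:R) s) ->
  egf (fun k => c * a1 k + d * a2 k + a3 k) s =
  c * egf a1 s + d * egf a2 s + egf a3 s.
Proof.
move=> e1 e2 e3.
apply: cvg_lim; first exact: Rhausdorff.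
rewrite (_ : pseries _ s = (fun n =>
    c * pseries (fun k => a1 k / k`!%:R) s n +
    d * pseries (fun k => a2 k / k`!%:R) s n) +
    pseries (fun k => a3 k / k`!%:R) s).
  apply: cvgD e3; apply: cvgD; [exact: cvgMl_tmp e1|exact: cvgMl_tmp e2].
apply/funext => n; rewrite /pseries /series !fctE /= !mulr_sumr -!big_split /=.
by apply: eq_bigr => k _; ring.
Qed.

End egf_theory.

Lemma is_derive_continuous (R : realType) (f : R -> R) (x l : R) :
  is_derive x (1 : R) f l -> {for x, continuous f}.
Proof. by case=> df _; apply: differentiable_continuous; apply/derivable1_diffP. Qed.

(** * Decay at -oo of solutions of a forced scalar linear equation, in real coordinates *)

Section exponential_decay.
Variable R : realType.
Implicit Types (a b c d s : R) (f g p q : R -> R).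

Lemma is_derive_expRM c s :
  is_derive s (1 : R) (fun t => expR (c * t)) (c * expR (c * s)).
Proof.
have hl : is_derive s (1 : R) (fun t => c * t) c.
  have := @is_deriveZ _ _ _ (@id R) c s 1 1 _; rewrite /GRing.scale /= mulr1.
  by apply; exact: is_derive_id.
have := @is_derive1_comp R expR (fun t => c * t) s _ _ (is_derive_expR _) hl.
by rewrite mulrC.
Qed.

Lemma derive_ge0_ndecr f g s :
  (forall t, is_derive t (1 : R) f (g t)) -> (forall t, t <= 0 -> 0 <= g t) ->
  s <= 0 -> f s <= f 0.
Proof.
move=> fg g0 s0.
apply: (@ger0_derive1_ndecrNy R f 0) => //.
- by move=> x x0; rewrite derive1E (@derive_val _ _ _ _ _ _ _ (fg x)) g0// ltW// (itvP x0).
- apply: continuous_subspaceT => x.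
  exact: is_derive_continuous (fg x).
Qed.

(* Energy estimate: with c = a - d, V = (p^2 + q^2) e^{-2ds} satisfies
   V' >= c V - 2C^2/c, so (V - 2C^2/c^2) e^{-cs} is nondecreasing on s <= 0. *)
Lemma ode_decay a b d C p q g1 g2 : d < a ->
  (forall s, is_derive s (1 : R) p (a * p s + (- b) * q s + g1 s)) ->
  (forall s, is_derive s (1 : R) q (b * p s + a * q s + g2 s)) ->
  (forall s, s <= 0 -> `|g1 s| <= C * expR (d * s)) ->
  (forall s, s <= 0 -> `|g2 s| <= C * expR (d * s)) ->
  exists D, forall s, s <= 0 ->
    `|p s| <= D * expR (d * s) /\ `|q s| <= D * expR (d * s).
Proof.
move=> da hp hq hg1 hg2; pose c := a - d; have c0 : 0 < c by rewrite subr_gt0.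
pose L := 2 * C ^+ 2 / c ^+ 2.
pose E s := expR (- d * s); pose F s := expR (- c * s).
pose V := (p * p + q * q) * (E * E).
pose W := (V - cst L) * F.
pose W' s := F s * (c * (E s * p s) ^+ 2 + c * (E s * q s) ^+ 2
  + 2 * (E s * p s) * (E s * g1 s) + 2 * (E s * q s) * (E s * g2 s) + c * L).
have hE s : E s * expR (d * s) = 1 by rewrite -expRD mulNr addNr expR0.
have E0 s : 0 < E s by exact: expR_gt0.
have hW s : is_derive s (1 : R) W (W' s).
  have dE := is_derive_expRM (- d) s; have dF := is_derive_expRM (- c) s.
  have dp := hp s; have dq := hq s.
  apply: is_derive_eq.
  rewrite /W' /V /GRing.scale /= !fctE /cst /= -/(E s) -/(F s).
  by rewrite /c; ring.
have W0 s : s <= 0 -> 0 <= W' s.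
  move=> s0; rewrite mulr_ge0 ?expR_ge0//.
  have hG g : `|g s| <= C * expR (d * s) -> (E s * g s) ^+ 2 <= C ^+ 2.
    move=> h; have {}h : `|E s * g s| <= C.
      rewrite normrM (gtr0_norm (E0 s)).
      by rewrite -(ler_pM2l (E0 s)) mulrCA hE mulr1 in h.
    by move: h; rewrite ler_norml => /andP[hl hr]; nra.
  have /hG h1 := hg1 s s0; have /hG h2 := hg2 s s0.
  have hL : c * L = 2 * C ^+ 2 / c by rewrite /L; field; rewrite gt_eqF.
  (* After multiplication by c, complete the squares: (cy)^2 + 2cyg = (cy + g)^2 - g^2. The term c^2
     L = 2C^2 pays for the two subtracted squares. *)
  rewrite hL -(pmulr_rge0 _ c0) mulrDr [c * (_ / c)]mulrC divfK ?gt_eqF//.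
  have := sqr_ge0 (c * (E s * p s) + E s * g1 s).
  have := sqr_ge0 (c * (E s * q s) + E s * g2 s).
  by move: (E s * p s) (E s * q s) (E s * g1 s) (E s * g2 s) h1 h2 => *; nra.
exists (Num.sqrt (L + `|V 0 - L|)).
have hV s : s <= 0 -> V s <= L + `|V 0 - L|.
  move=> s0; have := derive_ge0_ndecr hW W0 s0.
  rewrite /W !fctE /cst /= {2}/F mulr0 expR0 mulr1 => h.
  have F1 : 1 <= F s by rewrite -expR0 ler_expR; nra.
  (* Monotonicity bounds (V s - L) F s, not V s - L; since F s >= 1, removing F is legitimate when V
     s > L, and otherwise the bound is immediate. *)
  rewrite -lerBlDl; have [VL|VL] := leP (V s - L) 0; first exact: le_trans VL _.
  apply: (le_trans (ler_peMr (ltW VL) F1)); exact: le_trans h (ler_norm _).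
have key s u : s <= 0 -> (E s * u) ^+ 2 <= V s ->
    `|u| <= Num.sqrt (L + `|V 0 - L|) * expR (d * s).
  move=> s0 h; rewrite -(ler_pM2l (E0 s)) mulrCA hE mulr1.
  rewrite -(gtr0_norm (E0 s)) -normrM -sqrtr_sqr ler_wsqrtr//.
  exact: le_trans h (hV _ s0).
move=> s s0; split; apply: key => //; rewrite /V !fctE; nra.
Qed.

End exponential_decay.

(** * Real and imaginary parts of the entries of exp(sA) P *)

Section matrix_exponential.
Variable R : realType.
Local Notation C := R[i].
Implicit Types (z w : C).

Lemma cReD z w : complex.Re (z + w) = complex.Re z + complex.Re w.
Proof. by case: z w => [? ?] []. Qed.

Lemma cImD z w : complex.Im (z + w) = complex.Im z + complex.Im w.
Proof. by case: z w => [? ?] []. Qed.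

Lemma cReM z w : complex.Re (z * w) =
  complex.Re z * complex.Re w - complex.Im z * complex.Im w.
Proof. by case: z w => [? ?] []. Qed.

Lemma cImM z w : complex.Im (z * w) =
  complex.Re z * complex.Im w + complex.Im z * complex.Re w.
Proof. by case: z w => [? ?] []. Qed.

(** A submultiplicative size with values in [R], whereas the modulus on [R[i]] takes values in
    [R[i]]; it dominates both the real and the imaginary part. *)
Definition taxicab z : R := `|complex.Re z| + `|complex.Im z|.

Lemma taxicab_ge0 z : 0 <= taxicab z.
Proof. by rewrite addr_ge0. Qed.

Lemma taxicabD z w : taxicab (z + w) <= taxicab z + taxicab w.
Proof. by rewrite /taxicab cReD cImD addrACA lerD// ler_normD. Qed.

Lemma taxicabM z w : taxicab (z * w) <= taxicab z * taxicab w.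
Proof.
rewrite /taxicab cReM cImM mulrDl !mulrDr -!normrM.
by apply: le_trans (lerD (ler_normB _ _) (ler_normD _ _)) _; lra.
Qed.

Lemma taxicab_mulmx (M N P : nat) (A : 'M[C]_(M, N)) (B : 'M[C]_(N, P)) c i j :
  (forall l, taxicab (B l j) <= c) ->
  taxicab ((A *m B) i j) <= (\sum_l taxicab (A i l)) * c.
Proof.
move=> hB; rewrite mxE mulr_suml.
elim/big_rec2 : _ => [|l y x _ hx]; first by rewrite /taxicab /= normr0 addr0.
apply: le_trans (taxicabD _ _) _; rewrite lerD// (le_trans (taxicabM _ _))//.
by rewrite ler_wpM2l ?taxicab_ge0.
Qed.

(** M and K are the sums of the sizes of all entries of P and of A. Every row sum of A is at most K,
    so each further factor A on the left costs at most K. *)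
Lemma taxicab_expmx_bound (N : nat) (A P : 'M[C]_N) :
  exists M K, [/\ 0 <= M, 0 <= K &
    forall i j k, taxicab ((A ^+ k *m P) i j) <= M * K ^+ k].
Proof.
pose M := \sum_i \sum_j taxicab (P i j).
pose K := \sum_i \sum_j taxicab (A i j).
have s0 (B : 'M[C]_N) l : 0 <= \sum_j taxicab (B l j).
  by apply: sumr_ge0 => *; exact: taxicab_ge0.
have row_le (B : 'M[C]_N) l : \sum_j taxicab (B l j) <= \sum_i \sum_j taxicab (B i j).
  by rewrite [leRHS](bigD1 l)//= lerDl sumr_ge0.
have M0 : 0 <= M by rewrite sumr_ge0.
have K0 : 0 <= K by rewrite sumr_ge0.
exists M, K; split => // i j k; elim: k i => [|k ih] i.
  rewrite expr0 mul1mx mulr1 (le_trans _ (row_le P i))//.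
  by rewrite (bigD1 j)//= lerDl sumr_ge0// => *; exact: taxicab_ge0.
rewrite exprS -mulmxE -mulmxA (le_trans (taxicab_mulmx _ i ih))//.
by rewrite exprS [leRHS]mulrCA ler_wpM2r ?mulr_ge0 ?exprn_ge0.
Qed.

(** With its companion [expmx_Im], an entry of exp(sA) P, split so that real calculus applies.
    Carrying P keeps the family stable: differentiation replaces P by AP, and peeling off a root r
    replaces P by (A - r)P. *)
Definition expmx_Re N (A P : 'M[C]_N) i j : R -> R :=
  egf (fun k => complex.Re ((A ^+ k *m P) i j)).

Definition expmx_Im N (A P : 'M[C]_N) i j : R -> R :=
  egf (fun k => complex.Im ((A ^+ k *m P) i j)).

Variable N : nat.
Implicit Types A P : 'M[C]_N.

Lemma expmx_entries_exp_bounded A P : exists M K, [/\ 0 <= M, 0 <= K &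
  forall i j, exp_bounded M K (fun k => complex.Re ((A ^+ k *m P) i j)) /\
              exp_bounded M K (fun k => complex.Im ((A ^+ k *m P) i j))].
Proof.
have [M [K [M0 K0 h]]] := taxicab_expmx_bound A P.
exists M, K; split => // i j.
by split=> k; apply: le_trans (h i j k); rewrite ?lerDl ?lerDr.
Qed.

Lemma expmx_Re_derive A P i j s :
  is_derive s (1 : R) (expmx_Re A P i j) (expmx_Re A (A *m P) i j s).
Proof.
have [M [K [M0 K0 /(_ i j)[h _]]]] := expmx_entries_exp_bounded A P.
rewrite /expmx_Re.
under [X in egf X s]eq_fun do rewrite mulmxA mulmxE -exprSr.
exact: egf_is_derive h.
Qed.

Lemma expmx_Im_derive A P i j s :
  is_derive s (1 : R) (expmx_Im A P i j) (expmx_Im A (A *m P) i j s).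
Proof.
have [M [K [M0 K0 /(_ i j)[_ h]]]] := expmx_entries_exp_bounded A P.
rewrite /expmx_Im.
under [X in egf X s]eq_fun do rewrite mulmxA mulmxE -exprSr.
exact: egf_is_derive h.
Qed.

Lemma expmx_growth A P : exists M K, forall i j s,
  `|expmx_Re A P i j s| <= M * expR (K * `|s|) /\
  `|expmx_Im A P i j s| <= M * expR (K * `|s|).
Proof.
have [M [K [M0 K0 h]]] := expmx_entries_exp_bounded A P.
exists M, K => i j s; have [h1 h2] := h i j.
by split; apply: egf_bound.
Qed.

(** From AP = aP + (A - a)P. Since AP also gives the derivative, each entry p of exp(sA) P solves p'
    = a p + g, with g the same entry of exp(sA)(A - a)P; this is the system of [ode_decay]. *)
Lemma expmx_shift A P a i j s : let P' := (A - a%:M) *m P in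
  expmx_Re A (A *m P) i j s = complex.Re a * expmx_Re A P i j s
    + (- complex.Im a) * expmx_Im A P i j s + expmx_Re A P' i j s /\
  expmx_Im A (A *m P) i j s = complex.Im a * expmx_Re A P i j s
    + complex.Re a * expmx_Im A P i j s + expmx_Im A P' i j s.
Proof.
move=> P'.
have [M1 [K1 [M10 K10 h1]]] := expmx_entries_exp_bounded A P.
have [M2 [K2 [M20 K20 h2]]] := expmx_entries_exp_bounded A P'.
have [h1r h1i] := h1 i j; have [h2r h2i] := h2 i j.
have c1r := egf_cvg (s := s) M10 K10 h1r; have c1i := egf_cvg (s := s) M10 K10 h1i.
have c2r := egf_cvg (s := s) M20 K20 h2r; have c2i := egf_cvg (s := s) M20 K20 h2i.
have split_entry k : (A ^+ k *m (A *m P)) i j =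
    a * (A ^+ k *m P) i j + (A ^+ k *m P') i j.
  have -> : A *m P = P' + a *: P by rewrite /P' mulmxBl mul_scalar_mx subrK.
  by rewrite mulmxDr -scalemxAr mxE [X in _ + X]mxE addrC.
rewrite /expmx_Re /expmx_Im.
rewrite -(egf_linear_comb _ _ c1r c1i c2r) -(egf_linear_comb _ _ c1r c1i c2i).
split; congr (egf _ s); apply/funext => k; rewrite split_entry.
  by rewrite cReD cReM mulNr.
by rewrite cImD cImM addrC addrA [_ + complex.Im a * _]addrC; lra.
Qed.

End matrix_exponential.

(** * Decay of exp(sA) as s tends to -oo, from the spectrum of A *)

Lemma expmx_decay_of_annihilator (R : realType) (N : nat) (A : 'M[R[i]]_N.+1)
    (d : R) (rs : seq R[i]) (P : 'M[R[i]]_N.+1) i j :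
  (forall r, r \in rs -> d < complex.Re r) ->
  horner_mx A (\prod_(r <- rs) ('X - r%:P)) *m P = 0 ->
  exists D, forall s, s <= 0 -> `|expmx_Re A P i j s| <= D * expR (d * s) /\
                                `|expmx_Im A P i j s| <= D * expR (d * s).
Proof.
elim: rs P => [|r rs ih] P hd.
  (* With no factor left, the annihilation hypothesis says P = 0. *)
  rewrite big_nil rmorph1 mul1mx => ->; exists 0 => s _; rewrite mul0r !normr_le0.
  have egf_mul0 (h : R[i] -> R) : h 0 = 0 ->
      egf (fun k => h ((A ^+ k *m 0) i j)) s = 0.
    by move=> h0; rewrite -[RHS](egf0 s); congr egf; apply/funext => k; rewrite mulmx0 mxE.
  by split; apply/eqP; exact: egf_mul0.
(* Commuting the product puts the factor A - r next to P, so the remaining factors annihilate (A -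
   r)P and the induction hypothesis bounds the forcing term. *)
rewrite big_cons mulrC rmorphM rmorphB /= horner_mx_X horner_mx_C -mulmxE -mulmxA.
set P' := (_ *m P) => /ih[|D hD]; first by move=> z zrs; apply: hd; rewrite inE zrs orbT.
have hP' : P' = (A - r%:M) *m P by [].
have hr : d < complex.Re r by apply: hd; rewrite mem_head.
have hRe s : is_derive s (1 : R) (expmx_Re A P i j) (complex.Re r * expmx_Re A P i j s
    + (- complex.Im r) * expmx_Im A P i j s + expmx_Re A P' i j s).
  by rewrite hP'; have [<- _] := expmx_shift A P r i j s; exact: expmx_Re_derive.
have hIm s : is_derive s (1 : R) (expmx_Im A P i j) (complex.Im r * expmx_Re A P i j s
    + complex.Re r * expmx_Im A P i j s + expmx_Im A P' i j s).
  by rewrite hP'; have [_ <-] := expmx_shift A P r i j s; exact: expmx_Im_derive.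
exact: (ode_decay hr hRe hIm (fun s s0 => (hD s s0).1) (fun s s0 => (hD s s0).2)).
Qed.

(** Finitely many strict inequalities leave a common gap, found by taking midpoints. Applied to the
    spectrum it yields an exponent strictly above -1, as integrability of u^d at 0 requires. *)
Lemma seq_lt_bound (R : realFieldType) (c : R) (rs : seq R) :
  (forall r, r \in rs -> c < r) -> exists2 d, c < d & forall r, r \in rs -> d < r.
Proof.
elim: rs => [|r rs ih] h; first by exists (c + 1) => //; rewrite ltrDl.
have [|d cd hd] := ih; first by move=> z zrs; apply: h; rewrite inE zrs orbT.
have cr := h r (mem_head _ _).
exists (Num.min d ((c + r) / 2)); first by rewrite lt_min cd; lra.
move=> z; rewrite inE gt_min => /predU1P[->|/hd ->//].
by apply/orP; right; lra.
Qed.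

(** Over the algebraically closed field [R[i]] the characteristic polynomial splits into factors
    whose roots are the eigenvalues, and by Cayley-Hamilton it annihilates the identity. *)
Lemma expmx_decay (R : realType) (N : nat) (A : 'M[R[i]]_N) (c : R) :
  (forall a, eigenvalue A a -> c < complex.Re a) ->
  exists2 d, c < d & forall i j, exists D, forall s, s <= 0 ->
    `|expmx_Re A 1%:M i j s| <= D * expR (d * s) /\
    `|expmx_Im A 1%:M i j s| <= D * expR (d * s).
Proof.
(* A matrix of size 0 has no entries, so any d above c serves. *)
case: N A => [A _|N A hA]; first by exists (c + 1) => [|[]//]; rewrite ltrDl.
have [rs hrs] := closed_field_poly_normal (char_poly A).
rewrite (monicP (char_poly_monic A)) scale1r in hrs.
have [|d cd hd] := @seq_lt_bound R c [seq complex.Re r | r <- rs].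
  move=> _ /mapP[r rrs ->]; apply: hA.
  by rewrite eigenvalue_root_char hrs root_prod_XsubC.
exists d => // i j; apply: (@expmx_decay_of_annihilator R N A d rs).
  by move=> r rrs; apply: hd; exact: map_f.
by rewrite -hrs Cayley_Hamilton mul0mx.
Qed.

(** * Integrability on the half-line *)

Section gamma_integrals.
Variable R : realType.
Local Notation mu := (@lebesgue_measure R).
Implicit Types (f g F : R -> R) (a b c d s x y u : R).

Lemma FTC2_integral_le f F a b L : a < b ->
  (forall u, a <= u -> u <= b -> is_derive u (1 : R) F (f u)) ->
  (forall u, a <= u -> u <= b -> {for u, continuous f}) ->
  F b - F a <= L -> (\int[mu]_(u in `[a, b]) (f u)%:E <= L%:E)%E.
Proof.
move=> ab dF cf hL.
have cF u : a <= u -> u <= b -> {for u, continuous F}.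
  by move=> au ub; exact: is_derive_continuous (dF u au ub).
rewrite (@continuous_FTC2 _ _ F) ?EFinN -?EFinB ?lee_fin//.
- apply: continuous_in_subspaceT => u; rewrite inE/= in_itv/= => /andP[au ub].
  exact: cf.
- split.
  + by move=> u; rewrite in_itv/= => /andP[au ub]; have [] := dF u (ltW au) (ltW ub).
  + by apply: cvg_at_right_filter; apply: cF => //; exact: ltW.
  + by apply: cvg_at_left_filter; apply: cF => //; exact: ltW.
- move=> u; rewrite in_itv/= => /andP[au ub].
  by rewrite derive1E; have [_ ->] := dF u (ltW au) (ltW ub).
Qed.

(** Monotone convergence along an exhaustion: a uniform bound on the pieces, here supplied by
    antiderivatives on compact intervals, bounds the whole integral. *)
Lemma ge0_integrable_bigcup f (D : set R) (S : (set R)^nat) L :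
  measurable D -> (forall n, measurable (S n)) ->
  {homo S : n m / (n <= m)%N >-> (n <= m)%O} -> D = \bigcup_n S n ->
  measurable_fun D f -> (forall u, D u -> 0 <= f u) ->
  (forall n, \int[mu]_(u in S n) (f u)%:E <= L%:E)%E ->
  mu.-integrable D (EFin \o f).
Proof.
move=> mD mS ndS DS mf f0 hL; apply/integrableP; split; first exact/measurable_EFinP.
have SD n : S n `<=` D by rewrite DS; exact: bigcup_sup.
rewrite (@eq_integral _ _ _ mu D (fun u => (f u)%:E)); last first.
  by move=> u; rewrite inE => Du /=; rewrite ger0_norm// f0.
have mfS n : measurable_fun (S n) (EFin \o f).
  by apply/measurable_EFinP; exact: measurable_funS (mD) (SD n) mf.
have f0S n u : S n u -> (0 <= (EFin \o f) u)%E.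
  by move=> /SD Du; rewrite lee_fin f0.
have cvgS := @ge0_nondecreasing_set_cvg_integral _ (measurableTypeR R) R S
  (EFin \o f) mu ndS mS mfS f0S.
rewrite DS -(cvg_lim _ cvgS)//; apply: le_lt_trans (ltry L).
by apply: lime_le; [apply/cvg_ex; eexists; exact: cvgS | exact: nearW].
Qed.

Lemma continuous_measurable_itv0y f :
  (forall u, 0 < u -> {for u, continuous f}) ->
  measurable_fun (`]0, +oo[ : set R) f.
Proof.
move=> cf; apply: open_continuous_measurable_fun => // u.
by rewrite inE/= in_itv/= andbT; exact: cf.
Qed.

Lemma continuous_powR d u : 0 < u -> {for u, continuous (fun v : R => v `^ d)}.
Proof. by move=> u0; exact: is_derive_continuous (is_derive1_powR d u0). Qed.

Lemma integrable_powR_itv01 d : -1 < d ->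
  mu.-integrable `]0, 1] (EFin \o (fun u => u `^ d)).
Proof.
move=> d1; have d0 : 0 < d + 1 by lra.
have i0 n : 0 < (n.+2%:R)^-1 :> R by rewrite invr_gt0.
(* The offset 2 keeps the left endpoint strictly below 1 already for n = 0. The bound 1/(d + 1) is
   the value at 1 of the antiderivative u^(d+1)/(d+1). *)
apply: (@ge0_integrable_bigcup _ _ (fun n => `[n.+2%:R^-1, 1]%classic) (d + 1)^-1) => //.
- move=> n m nm; apply/subsetPset => u/=; rewrite !in_itv/= => /andP[+ ->].
  by rewrite andbT; apply: le_trans; rewrite lef_pV2 ?posrE// ler_nat !ltnS.
- apply/seteqP; split => u /=; last first.
    by move=> [n _] /=; rewrite !in_itv/= => /andP[/(lt_le_trans (i0 n)) -> ->].
  rewrite in_itv/= => /andP[u0 u1].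
  exists (Num.truncn u^-1) => //=; rewrite in_itv/= u1 andbT.
  rewrite invf_ple ?posrE//.
  apply/ltW; apply: lt_le_trans (truncnS_gt _) _.
  by rewrite ler_nat.
- apply: measurable_funS (continuous_measurable_itv0y _) => //; last first.
    by move=> u u0; exact: continuous_powR.
  by move=> u /=; rewrite !in_itv/= => /andP[->].
- by move=> u _; exact: powR_ge0.
move=> n; apply: (@FTC2_integral_le _ (fun u => (d + 1)^-1 * u `^ (d + 1))).
- by rewrite invf_lt1// ltr1n.
- move=> u nu _; have u0 := lt_le_trans (i0 n) nu.
  have := is_derive1_powR (d + 1) u0; rewrite addrK => du.
  have := @is_deriveZ _ _ _ _ (d + 1)^-1 _ _ _ du.
  by rewrite /GRing.scale /= mulKf ?gt_eqF.
- by move=> u nu _; apply: continuous_powR; exact: lt_le_trans nu.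
- by rewrite powR1 mulr1 gerBl mulr_ge0 ?invr_ge0 ?powR_ge0// ltW.
Qed.

Lemma continuous_expRM c u : {for u, continuous (fun v : R => expR (c * v))}.
Proof. exact: is_derive_continuous (is_derive_expRM c u). Qed.

Lemma integrable_expR_itv1y c : 0 < c ->
  mu.-integrable `[1, +oo[ (EFin \o (fun u => expR (- c * u))).
Proof.
move=> c0; apply: (@ge0_integrable_bigcup _ _ (fun n => `[1, 1 + n.+1%:R]%classic) c^-1) => //.
- move=> n m nm; apply/subsetPset => u/=; rewrite !in_itv/= => /andP[->] /=.
  by move=> /le_trans; apply; rewrite lerD2l ler_nat.
- apply/seteqP; split => u /=; last first.
    by move=> [n _] /=; rewrite !in_itv/= => /andP[-> _].
  rewrite in_itv/= andbT => u1; exists (Num.truncn u) => //=; rewrite in_itv/= u1.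
  by apply/ltW; apply: lt_le_trans (truncnS_gt _) _; rewrite lerDr.
- apply: measurable_funS (continuous_measurable_itv0y _) => //; last first.
    by move=> u _; exact: continuous_expRM.
  by move=> u /=; rewrite !in_itv/= !andbT; exact: lt_le_trans.
move=> n; apply: (@FTC2_integral_le _ (fun u => (- c^-1) * expR (- c * u))).
- by rewrite ltrDl.
- move=> u _ _.
  have := @is_deriveZ _ _ _ _ (- c^-1) _ _ _ (is_derive_expRM (- c) u).
  by rewrite /GRing.scale /= mulrA mulrNN mulVf ?gt_eqF// mul1r.
- by move=> u _ _; exact: continuous_expRM.
- set e1 := expR _; have e10 : 0 < e1 by exact: expR_gt0.
  have e21 : expR (- c * 1) <= 1 by rewrite -[leRHS]expR0 ler_expR mulr1; lra.
  have c'0 : 0 < c^-1 by rewrite invr_gt0.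
  by nra.
Qed.

Lemma expR_ln_subexponential K :
  exists L, forall u, 1 <= u -> expR (K * ln u) <= L * expR (2^-1 * u).
Proof.
(* T makes |K|/T at most 1/2, so ln (u/T) < u/T gives |K| ln u <= |K| ln T + u/2. *)
pose T := 2 * (`|K| + 1); have T0 : 0 < T by rewrite mulr_gt0// ltr_wpDl.
exists (expR (`|K| * ln T)) => u u1; rewrite -expRD ler_expR.
have u0 : 0 < u by exact: lt_le_trans u1.
have : ln (u / T) < u / T by apply: ln_sublinear; rewrite divr_gt0.
rewrite ln_div ?posrE// => h.
have hT : `|K| * (u / T) <= 2^-1 * u.
  rewrite mulrA ler_pdivrMr// /T; have := normr_ge0 K; nra.
have hK : K * ln u <= `|K| * ln u by rewrite ler_wpM2r ?ln_ge0// ler_norm.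
by have := normr_ge0 K; nra.
Qed.


Lemma integrable_setU_disjoint (A B : set R) f :
  measurable A -> measurable B -> [disjoint A & B] ->
  mu.-integrable A (EFin \o f) -> mu.-integrable B (EFin \o f) ->
  mu.-integrable (A `|` B) (EFin \o f).
Proof.
move=> mA mB AB /integrableP[mfA fA] /integrableP[mfB fB].
have mAB : measurable_fun (A `|` B) (EFin \o f).
  by apply/measurable_funU.
apply/integrableP; split => //; rewrite integral_setU//.
  exact: lte_add_pinfty.
exact: measurableT_comp.
Qed.

Lemma continuous_expRN_mul_ln f u : (forall s, {for s, continuous f}) -> 0 < u ->
  {for u, continuous (fun v : R => expR (- v) * f (ln v))}.
Proof.
move=> cf u0; apply: (@continuousM _ _ (fun v : R => expR (- v)) (f \o @ln R)).
  by apply: continuous_comp; [exact: continuousN|exact: continuous_expR].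
by apply: continuous_comp; [exact: continuous_ln|exact: cf].
Qed.

(** The two bounds on f serve on the two sides of u = 1, where ln u changes sign: D u^d dominates on
    ]0, 1], and a multiple of e^(-u/2) dominates on [1, +oo[. *)
Lemma integrable_expRN_mul_ln f d D M K :
  (forall s, {for s, continuous f}) -> -1 < d ->
  (forall s, s <= 0 -> `|f s| <= D * expR (d * s)) ->
  (forall s, `|f s| <= M * expR (K * `|s|)) ->
  mu.-integrable `]0, +oo[ (EFin \o (fun u => expR (- u) * f (ln u))).
Proof.
move=> cf d1 hD hM; pose g u := expR (- u) * f (ln u).
have mg : measurable_fun (`]0, +oo[ : set R) g.
  by apply: continuous_measurable_itv0y => u u0; exact: continuous_expRN_mul_ln.
have i01 : mu.-integrable `]0, 1] (EFin \o g).
  apply: (@le_integrable _ _ R mu _ _ _ (EFin \o (fun u => D * u `^ d))) => //.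
  - apply/measurable_EFinP; apply: measurable_funS mg => //.
    by move=> u /=; rewrite !in_itv/= => /andP[->].
  - move=> u /=; rewrite in_itv/= => /andP[u0 u1]; rewrite lee_fin.
    apply: le_trans (ler_norm _); rewrite /g normrM gtr0_norm ?expR_gt0//.
    have := hD (ln u) (ln_le0 u1).
    rewrite [in _ -> _]/powR gt_eqF// => h.
    have : expR (- u) <= 1 by rewrite -expR0 ler_expR oppr_le0 ltW.
    by have := expR_gt0 (- u); have := normr_ge0 (f (ln u)); nra.
  - have -> : EFin \o (fun u => D * u `^ d) = (fun u => (D%:E * (u `^ d)%:E)%E).
      by apply/funext => u /=; rewrite EFinM.
    by apply: integrableZl => //; exact: integrable_powR_itv01.
have [L hL] := expR_ln_subexponential K.
have M0 : 0 <= M.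
  by have := le_trans (normr_ge0 _) (hM 0); rewrite normr0 mulr0 expR0 mulr1.
have i1y : mu.-integrable `[1, +oo[ (EFin \o g).
  apply: (@le_integrable _ _ R mu _ _ _
    (EFin \o (fun u => M * L * expR (- 2^-1 * u)))) => //.
  - apply/measurable_EFinP; apply: measurable_funS mg => //.
    by move=> u /=; rewrite !in_itv/= !andbT; exact: lt_le_trans.
  - move=> u /=; rewrite in_itv/= andbT => u1; rewrite lee_fin.
    apply: le_trans (ler_norm _); rewrite /g normrM gtr0_norm ?expR_gt0//.
    have -> : - 2^-1 * u = - u + 2^-1 * u by lra.
    rewrite expRD mulrCA ler_pM2l ?expR_gt0// (le_trans (hM _))//.
    by rewrite -mulrA ler_wpM2l// ger0_norm ?ln_ge0// hL.
  - have -> : EFin \o (fun u => M * L * expR (- 2^-1 * u)) =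
        (fun u => ((M * L)%:E * (expR (- 2^-1 * u))%:E)%E).
      by apply/funext => u /=; rewrite EFinM.
    by apply: integrableZl => //; exact: integrable_expR_itv1y.
have U : `]0, 1] `|` `]1, +oo[ = `]0, +oo[ :> set R.
  apply/seteqP; split => u /=; rewrite !in_itv/= !andbT.
    by case=> [/andP[]//|]; exact: lt_trans.
  by move=> ->; apply/orP; case: leP.
rewrite -U in mg *; apply: integrable_setU_disjoint => //.
  apply/disj_setPS => u [] /=.
  by rewrite !in_itv/= andbT => /andP[_ u1]; rewrite ltNge u1.
apply: integrableS i1y => // u /=; rewrite !in_itv/= !andbT; exact: ltW.
Qed.

(** * Differentiation of an integral in its endpoint *)

Lemma derive_integral_itv0 g x : 0 < x ->
  mu.-integrable `]0, +oo[ (EFin \o g) -> {for x, continuous g} ->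
  h^-1 * (\int[mu]_(u in `]0%R, (x + h)%R]) g u
          - \int[mu]_(u in `]0%R, x]) g u) @[h --> (0 : R)^'] --> g x.
Proof.
move=> x0 ig cg.
(* The fundamental theorem at x needs integrability on an interval reaching past x. *)
have i0 : mu.-integrable `]0, x + 1] (EFin \o g).
  apply: integrableS ig => //.
  by move=> u /=; rewrite !in_itv/= => /andP[->].
have x1 : x < x + 1 by rewrite ltrDl.
have bx : (BRight (0 : R) < BRight x)%O by rewrite bnd_simp.
have [dF <-] := continuous_FTC1 x1 i0 bx cg.
rewrite derive1E; have := dF; rewrite /derivable /derive => /cvg_ex[l hl].
rewrite (cvg_lim _ hl)//.
apply: cvg_trans hl; apply: near_eq_cvg; apply: nearW => h /=.
by rewrite /GRing.scale /= mulr1 [h + x]addrC.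
Qed.

(** The integral over [y, +oo[ is a constant minus the integral over ]0, y], so the difference
    quotient is the opposite of the one already treated. *)
Lemma derive_integral_itvy g x : 0 < x ->
  mu.-integrable `]0, +oo[ (EFin \o g) -> {for x, continuous g} ->
  h^-1 * (\int[mu]_(u in `[(x + h)%R, +oo[) g u
          - \int[mu]_(u in `[x, +oo[) g u) @[h --> (0 : R)^'] --> - g x.
Proof.
move=> x0 ig cg.
have split_int y : 0 < y -> \int[mu]_(u in `[y, +oo[) g u =
    \int[mu]_(u in `]0%R, +oo[) g u - \int[mu]_(u in `]0%R, y]) g u.
  move=> y0; apply/eqP; rewrite eq_sym subr_eq; apply/eqP.
  have i0y : mu.-integrable `]0, y[ (EFin \o g).
    apply: integrableS ig => //.
    by move=> u /=; rewrite !in_itv/= => /andP[->].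
  (* Dropping the null point y makes the two pieces disjoint. *)
  rewrite -(Rintegral_itv_bndo_bndc i0y) addrC.
  have U : `]0, y[ `|` `[y, +oo[ = `]0, +oo[ :> set R.
    apply/seteqP; split => u /=; rewrite !in_itv/= !andbT.
      by case=> [/andP[]//|]; exact: lt_le_trans.
    by move=> ->; apply/orP; case: ltP.
  have disj : [disjoint (`]0%R, y[ : set R) & `[y, +oo[].
    apply/disj_setPS => u [] /=.
    by rewrite !in_itv/= andbT => /andP[_ uy]; rewrite leNgt uy.
  by rewrite -U Rintegral_setU ?U.
apply: cvg_trans (cvgN (derive_integral_itv0 x0 ig cg)).
(* The splitting holds at positive points only, so h is kept small enough for x + h > 0. *)
apply: near_eq_cvg; near=> h.
have xh : 0 < x + h; last by rewrite fctE (split_int _ x0) (split_int _ xh); ring.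
have : `|h| < x by near: h; exact: dnbhs0_lt.
by rewrite ltr_norml => /andP[]; rewrite -subr_gt0 opprK addrC.
Unshelve. all: end_near. Qed.

End gamma_integrals.

(** * Passage from complex matrices to real entries *)

Section entrywise_limits.
Variable R : realType.
Local Notation C := R[i].

Lemma Re_sum I (r : seq I) (F : I -> C) :
  complex.Re (\sum_(k <- r) F k) = \sum_(k <- r) complex.Re (F k).
Proof. by apply: (big_morph (@complex.Re R)) => //; exact: cReD. Qed.

Lemma Im_sum I (r : seq I) (F : I -> C) :
  complex.Im (\sum_(k <- r) F k) = \sum_(k <- r) complex.Im (F k).
Proof. by apply: (big_morph (@complex.Im R)) => //; exact: cImD. Qed.

Lemma Re_realM (c : R) (z : C) : complex.Re (c%:C * z) = c * complex.Re z.
Proof. by rewrite cReM /= mul0r subr0. Qed.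

Lemma Im_realM (c : R) (z : C) : complex.Im (c%:C * z) = c * complex.Im z.
Proof. by rewrite cImM /= mul0r addr0. Qed.

Lemma norm_le_taxicab (z : C) : `|z| <= (taxicab z)%:C.
Proof.
rewrite normc_def lecR -(@ger0_norm _ (taxicab z)) ?taxicab_ge0// -sqrtr_sqr.
rewrite ler_wsqrtr// /taxicab sqrrD !real_normK ?num_real//.
by have := mulr_ge0 (normr_ge0 (complex.Re z)) (normr_ge0 (complex.Im z)); lra.
Qed.

Lemma cvg_mx_ReIm (N : nat) T (F : set_system T) {FF : Filter F}
    (f : T -> 'M[C]_N) (L : 'M[C]_N) :
  (forall i j, complex.Re (f t i j) @[t --> F] --> complex.Re (L i j)) ->
  (forall i j, complex.Im (f t i j) @[t --> F] --> complex.Im (L i j)) ->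
  f @ F --> L.
Proof.
move=> hRe hIm; apply/cvg_ballP => e e0.
(* Radii live in [R[i]]; being positive, e is real, and half of it is allotted to each of the two
   parts. *)
have eE : e = (complex.Re e)%:C.
  by rewrite RRe_real// realE ltW.
have e'0 : 0 < complex.Re e / 2 by rewrite divr_gt0 //; rewrite eE ltcR in e0.
have hij i j : \forall t \near F, ball (L i j) e (f t i j).
  have /cvgrPdist_lt /(_ _ e'0) hr := hRe i j.
  have /cvgrPdist_lt /(_ _ e'0) hi := hIm i j.
  apply: filterS2 hr hi => t hr hi; rewrite -ball_normE /=.
  rewrite eE; apply: le_lt_trans (norm_le_taxicab _) _; rewrite ltcR /taxicab.
  by move: hr hi; case: (L i j) (f t i j) => [a b] [c d] /=; lra.
have hi i : \forall t \near F, forall j, ball (L i j) e (f t i j).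
  exact: filter_forall.
have h : \forall t \near F, forall i j, ball (L i j) e (f t i j).
  exact: filter_forall.
by apply: filterS h => t ht; split.
Qed.

(** Entry by entry, the partial sums of the matrix exponential series have as real and imaginary
    parts the partial sums of two convergent real series; uniqueness of limits then identifies
    [limn]. *)
Lemma powmx_entry (N : nat) (A : 'M[C]_N) (t : R) i j :
  powmx t A i j = expmx_Re A 1%:M i j (ln t) +i* expmx_Im A 1%:M i j (ln t).
Proof.
rewrite /powmx /expmx; set s := ln t.
have expZ k : (s%:C *: A) ^+ k = (s ^+ k)%:C *: A ^+ k.
  elim: k => [|k ih]; first by rewrite !expr0 scale1r.
  by rewrite !exprS ih -!mulmxE -scalemxAl -scalemxAr scalerA rmorphM.
have entryE k a b : ((k`!%:R : C)^-1 *: (s%:C *: A) ^+ k) a b =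
    (k`!%:R^-1 * s ^+ k)%:C * (A ^+ k *m 1%:M) a b.
  by rewrite expZ scalerA mulmx1 mxE rmorphM /= fmorphV rmorph_nat.
have [M [K [M0 K0 hb]]] := expmx_entries_exp_bounded A 1%:M.
pose L := \matrix_(i, j) (expmx_Re A 1%:M i j s +i* expmx_Im A 1%:M i j s) : 'M[C]_N.
transitivity (L i j); last by rewrite mxE.
congr (fun_of_matrix _ i j); apply: cvg_lim; first exact: norm_hausdorff.
apply: cvg_mx_ReIm => a b; rewrite mxE /=; have [hRe hIm] := hb a b.
- apply: cvg_trans (egf_cvg (s := s) M0 K0 hRe); apply: near_eq_cvg.
  apply: nearW => n; rewrite /pseries /series /= summxE Re_sum.
  by apply: eq_bigr => k _; rewrite entryE Re_realM; ring.
- apply: cvg_trans (egf_cvg (s := s) M0 K0 hIm); apply: near_eq_cvg.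
  apply: nearW => n; rewrite /pseries /series /= summxE Im_sum.
  by apply: eq_bigr => k _; rewrite entryE Im_realM; ring.
Qed.

Lemma continuous_expmx_Re N (A P : 'M[C]_N) i j s :
  {for s, continuous (expmx_Re A P i j)}.
Proof. exact: is_derive_continuous (expmx_Re_derive A P i j s). Qed.

Lemma continuous_expmx_Im N (A P : 'M[C]_N) i j s :
  {for s, continuous (expmx_Im A P i j)}.
Proof. exact: is_derive_continuous (expmx_Im_derive A P i j s). Qed.

Lemma Re_gamma_integrand N (Q : 'M[C]_N) u i j :
  complex.Re (gamma_integrand Q u i j) =
  expR (- u) * expmx_Re (Q - 1%:M) 1%:M i j (ln u).
Proof. by rewrite mxE Re_realM powmx_entry. Qed.

Lemma Im_gamma_integrand N (Q : 'M[C]_N) u i j :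
  complex.Im (gamma_integrand Q u i j) =
  expR (- u) * expmx_Im (Q - 1%:M) 1%:M i j (ln u).
Proof. by rewrite mxE Im_realM powmx_entry. Qed.

Lemma has_mx_derivative_ReIm N (F : R -> 'M[C]_N) x (L : 'M[C]_N) :
  (forall i j, h^-1 * (complex.Re (F (x + h) i j) - complex.Re (F x i j))
     @[h --> (0 : R)^'] --> complex.Re (L i j)) ->
  (forall i j, h^-1 * (complex.Im (F (x + h) i j) - complex.Im (F x i j))
     @[h --> (0 : R)^'] --> complex.Im (L i j)) ->
  has_mx_derivative F x L.
Proof.
move=> hRe hIm; apply: cvg_mx_ReIm => i j.
- apply: cvg_trans (hRe i j); apply: near_eq_cvg; apply: nearW => h /=.
  by rewrite !mxE Re_realM; case: (F _ i j) (F x i j) => [a b] [c d].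
- apply: cvg_trans (hIm i j); apply: near_eq_cvg; apply: nearW => h /=.
  by rewrite !mxE Im_realM; case: (F _ i j) (F x i j) => [a b] [c d].
Qed.

End entrywise_limits.

(** * Derivatives of the incomplete gamma matrix functions *)

Theorem theorem2p3 (R : realType) (N : nat) (Q : 'M[R[i]]_N)
    (hQ : forall a : R[i], eigenvalue Q a -> 0 < complex.Re a)
    (x : R) (hx : 0 < x) :
  has_mx_derivative (lower_gammamx Q) x
    ((expR (- x))%:C *: powmx x (Q - 1%:M)) /\
  has_mx_derivative (upper_gammamx Q) x
    (- ((expR (- x))%:C *: powmx x (Q - 1%:M))).
Proof.
(* An eigenvector of Q - I for a is an eigenvector of Q for a + 1. *)
have hA a : eigenvalue (Q - 1%:M) a -> -1 < complex.Re a.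
  move=> /eigenvalueP[v hv v0]; rewrite -subr_gt0 opprK.
  suff : 0 < complex.Re (a + 1) by case: (a).
  apply: hQ; apply/eigenvalueP; exists v => //.
  by rewrite -[Q](subrK 1%:M) mulmxDr hv mulmx1 scalerDl scale1r.
have [d d1 decay] := expmx_decay hA.
have [M [K growth]] := expmx_growth (Q - 1%:M) 1%:M.
pose gRe i j u := complex.Re (gamma_integrand Q u i j).
pose gIm i j u := complex.Im (gamma_integrand Q u i j).
have ReE i j : gRe i j = fun u => expR (- u) * expmx_Re (Q - 1%:M) 1%:M i j (ln u).
  by apply/funext => u; exact: Re_gamma_integrand.
have ImE i j : gIm i j = fun u => expR (- u) * expmx_Im (Q - 1%:M) 1%:M i j (ln u).
  by apply/funext => u; exact: Im_gamma_integrand.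
have cRe i j : {for x, continuous (gRe i j)}.
  rewrite ReE; apply: continuous_expRN_mul_ln => // s; exact: continuous_expmx_Re.
have cIm i j : {for x, continuous (gIm i j)}.
  rewrite ImE; apply: continuous_expRN_mul_ln => // s; exact: continuous_expmx_Im.
have iRe i j : lebesgue_measure.-integrable `]0, +oo[ (EFin \o gRe i j).
  have [D hD] := decay i j; rewrite ReE.
  apply: (integrable_expRN_mul_ln _ d1 (fun s s0 => (hD s s0).1)
    (fun s => (growth i j s).1)) => s; exact: continuous_expmx_Re.
have iIm i j : lebesgue_measure.-integrable `]0, +oo[ (EFin \o gIm i j).
  have [D hD] := decay i j; rewrite ImE.
  apply: (integrable_expRN_mul_ln _ d1 (fun s s0 => (hD s s0).2)
    (fun s => (growth i j s).2)) => s; exact: continuous_expmx_Im.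
have ReN i j : complex.Re ((- gamma_integrand Q x) i j) = - gRe i j x.
  by rewrite mxE /gRe; case: (gamma_integrand _ _ _ _).
have ImN i j : complex.Im ((- gamma_integrand Q x) i j) = - gIm i j x.
  by rewrite mxE /gIm; case: (gamma_integrand _ _ _ _).
(* The claimed derivatives are the integrand at x and its opposite, so each of the four entrywise
   goals is a scalar endpoint derivative. *)
rewrite -/(gamma_integrand Q x); split; apply: has_mx_derivative_ReIm => i j.
- under eq_cvg do rewrite !mxE /=.
  exact: (derive_integral_itv0 hx (iRe i j) (cRe i j)).
- under eq_cvg do rewrite !mxE /=.
  exact: (derive_integral_itv0 hx (iIm i j) (cIm i j)).
- rewrite ReN; under eq_cvg do rewrite !mxE /=.
  exact: (derive_integral_itvy hx (iRe i j) (cRe i j)).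
- rewrite ImN; under eq_cvg do rewrite !mxE /=.
  exact: (derive_integral_itvy hx (iIm i j) (cIm i j)).
Qed.
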